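(* Let $\mathcal{P}$ be a non-trivial constant probability (CP) program without direct termination (i.e. $p'=0$) which is positively almost surely terminating, i.e. the drift $\mu_{\mathcal{P}^{\mathit{rdw}}}=\sum_{-k_{\mathcal{P}}\le j\le m_{\mathcal{P}}} j\,p^{\mathit{rdw}}_j$ satisfies $\mu_{\mathcal{P}^{\mathit{rdw}}}<0$. Then for $\vec{x}_0\in\mathbb{Z}^r$: if $\mathit{rdw}_{\mathcal{P}}(\vec{x}_0)\le0$ then $rt^{\mathcal{P}}_{\vec{x}_0}=0$; if $\mathit{rdw}_{\mathcal{P}}(\vec{x}_0)>0$ then $$-\tfrac{1}{\mu_{\mathcal{P}^{\mathit{rdw}}}}\cdot\mathit{rdw}_{\mathcal{P}}(\vec{x}_0)\;\le\; rt^{\mathcal{P}}_{\vec{x}_0}\;\le\;-\tfrac{1}{\mu_{\mathcal{P}^{\mathit{rdw}}}}\cdot\mathit{rdw}_{\mathcal{P}}(\vec{x}_0)+\tfrac{1-k_{\mathcal{P}}}{\mu_{\mathcal{P}^{\mathit{rdw}}}}.$$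
   Context: A CP program $\mathcal{P}$: while $(\vec{a}\bullet\vec{x}>b)$ do: $\vec{x}:=\vec{x}+\vec{c}_u$ with constant probability $p_{\vec{c}_u}$ ($1\le u\le n$); $\vec{x}:=\vec{d}$ with constant probability $p'$; with $\vec{x}\in\mathbb{Z}^r$, $\vec{a},\vec{c}_u,\vec{d}\in\mathbb{Z}^r$, $\vec{c}_u$ pairwise distinct, $b\in\mathbb{Z}$, $\vec{a}\bullet\vec{d}\le b$, probabilities nonnegative summing to 1. Semantics: Markov chain on $\mathbb{Z}^r$ starting at $\vec{x}_0$ which, in a state satisfying the guard, moves to $\vec{z}+\vec{c}_u$ w.p. $p_{\vec{c}_u}$ and to $\vec{d}$ w.p. $p'$, and stays put in states violating the guard; $T$ = first index of a run violating the guard; $rt^{\mathcal{P}}_{\vec{x}_0}=\mathbb{E}_{\vec{x}_0}(T)$ if $\mathbb{P}_{\vec{x}_0}(T<\infty)=1$ and $\infty$ otherwise; PAST means $rt^{\mathcal{P}}_{\vec{x}_0}<\infty$ for all $\vec{x}_0$. Further, $\mathit{rdw}_{\mathcal{P}}(\vec{z})=\vec{a}\bullet\vec{z}-b$; $k_{\mathcal{P}},m_{\mathcal{P}}\in\mathbb{N}$ are minimal with $-k_{\mathcal{P}}\le\vec{a}\bullet\vec{c}_u\le m_{\mathcal{P}}$ for all $u$; $p^{\mathit{rdw}}_j=\sum_{u:\vec{a}\bullet\vec{c}_u=j}p_{\vec{c}_u}$; $\mathcal{P}^{\mathit{rdw}}$ is the program while $(x>0)$ do $x:=x+j$ w.p.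 $p^{\mathit{rdw}}_j$ ($-k_{\mathcal{P}}\le j\le m_{\mathcal{P}}$), $x:=\mathit{rdw}_{\mathcal{P}}(\vec{d})$ w.p. $p'$. $\mathcal{P}$ is trivial if $\vec{a}=\vec{0}$ or $\mathcal{P}^{\mathit{rdw}}$ is exactly ''while $(x>0)$ do $x:=x$ with probability 1''. *)

(* Defs.v *)
From HB Require Import structures.
From mathcomp Require Import all_boot all_order all_algebra.
From mathcomp Require Import all_classical all_reals all_analysis.

Set Implicit Arguments.
Unset Strict Implicit.
Unset Printing Implicit Defensive.
Import Order.TTheory GRing.Theory Num.Theory.

Local Open Scope classical_set_scope.
Local Open Scope ring_scope.

Definition dotz (r : nat) (x y : 'rV[int]_r) : int := \sum_i x 0 i * y 0 i.

(* while (cp_guard . x > cp_bound) do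
     x := x + cp_step u   with probability cp_prob u,
     x := cp_exit         with probability cp_exit_prob *)
Record cp_program (R : realType) (r : nat) := CPProgram {
  cp_guard : 'rV[int]_r;
  cp_bound : int;
  cp_size : nat;
  cp_step : 'I_cp_size -> 'rV[int]_r;
  cp_prob : 'I_cp_size -> R;
  cp_exit : 'rV[int]_r;
  cp_exit_prob : R;
  cp_step_inj : injective cp_step;
  cp_prob_ge0 : forall u, 0 <= cp_prob u;
  cp_exit_prob_ge0 : 0 <= cp_exit_prob;
  cp_prob_sum : \sum_u cp_prob u + cp_exit_prob = 1;
  cp_exitP : dotz cp_guard cp_exit <= cp_bound }.
Arguments cp_step {R r} c u.
Arguments cp_prob {R r} c u.

Section Semantics.
Context {R : realType} {r : nat}.
Implicit Types (P : cp_program R r) (z : 'rV[int]_r).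

Definition in_guard P z : bool := cp_bound P < dotz (cp_guard P) z.

Definition trans_prob P z z' : R :=
  if in_guard P z then
    \sum_(u | z + cp_step P u == z') cp_prob P u +
    (if z' == cp_exit P then cp_exit_prob P else 0)
  else (z' == z)%:R.

Fixpoint path_prob P z (f : seq 'rV[int]_r) : R :=
  if f is z' :: f' then trans_prob P z z' * path_prob P z' f' else 1.

End Semantics.

Definition run (r : nat) := nat -> 'rV[int]_r.
HB.instance Definition _ r := Choice.on (run r).
HB.instance Definition _ r := isPointed.Build (run r) (fun=> 0).

Definition cylinder (r : nat) (f : seq 'rV[int]_r) : set (run r) :=
  [set w | mkseq w (size f) = f].

Notation runs r := (g_sigma_algebraType (range (@cylinder r))).

Definition is_run_measure (R : realType) (r : nat) (P : cp_program R r)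
    (x0 : 'rV[int]_r) (mu : set (runs r) -> \bar R) : Prop :=
  forall (z : 'rV[int]_r) (f : seq 'rV[int]_r),
    mu (cylinder (z :: f)) = ((z == x0)%:R * path_prob P z f)%:E.

(* Existence of the run measure: the digits of a uniform point of [0, 1[ in the
   expansion whose k-th digit is u with probability q u are independent, and
   they drive the chain. *)
Section Digits.
Variables (R : realType) (N : nat) (q : 'I_N.+1 -> R).
Hypothesis q0 : forall u, 0 <= q u.
Hypothesis q1 : \sum_u q u = 1.

Let F (k : nat) := \sum_(i < N.+1 | (i < k)%N) q i.

Let F_0 : F 0 = 0. Proof. by rewrite /F big_pred0. Qed.

Let F_S (u : 'I_N.+1) : F u.+1 = F u + q u.
Proof.
rewrite /F (bigD1 u) ?ltnSn //= addrC; congr (_ + _); apply: eq_bigl => i.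
by rewrite ltnS [RHS]ltn_neqAle andbC.
Qed.

Let F_max : F N.+1 = 1.
Proof. by rewrite -q1; apply: eq_bigl => i; rewrite ltn_ord. Qed.

Let F_le (j k : nat) : (j <= k)%N -> F j <= F k.
Proof.
move=> jk; rewrite /F (bigID (fun i : 'I_N.+1 => (i < j)%N) (fun i => (i < k)%N)).
have -> : \sum_(i < N.+1 | (i < k)%N && (i < j)%N) q i = \sum_(i < N.+1 | (i < j)%N) q i.
  apply: eq_bigl => i; case: (ltnP i j) => ij; rewrite ?andbF // andbT.
  exact: leq_trans ij jk.
by rewrite lerDl sumr_ge0.
Qed.

Let F_ge0 k : 0 <= F k. Proof. by rewrite -F_0 F_le. Qed.

Let Fq_le1 (u : 'I_N.+1) : F u + q u <= 1.
Proof. by rewrite -F_S -F_max F_le. Qed.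

Let hit (y : R) (u : 'I_N.+1) := F u <= y < F u + q u.

Let hit_uniq y u v : hit y u -> hit y v -> u = v.
Proof.
rewrite /hit -!F_S => /andP[a1 a2] /andP[b1 b2]; apply/val_inj/eqP => /=.
rewrite eqn_leq; apply/andP; split.
  by rewrite leqNgt; apply/negP => /F_le/(lt_le_trans b2); rewrite ltNge a1.
by rewrite leqNgt; apply/negP => /F_le/(lt_le_trans a2); rewrite ltNge b1.
Qed.

Let hit_ex y : 0 <= y < 1 -> exists u, hit y u.
Proof.
move=> /andP[y0 y1].
have ex : exists k, y < F k by exists N.+1; rewrite F_max.
case: (ex_minnP ex) => -[|k] yk mk; first by move: yk; rewrite F_0 ltNge y0.
have kN : (k < N.+1)%N by apply: mk; rewrite F_max.
exists (Ordinal kN); rewrite /hit -F_S yk andbT leNgt.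
by apply/negP => /mk /=; rewrite ltnn.
Qed.

Definition digit (y : R) : 'I_N.+1 := odflt ord0 [pick u | hit y u].

Let digitP y u : 0 <= y < 1 -> (digit y == u) = hit y u.
Proof.
move=> y01; rewrite /digit; case: pickP => [v hv|no]; last first.
  by have [v] := hit_ex y01; rewrite no.
apply/eqP/idP => [<- //|hu]; exact: hit_uniq hv hu.
Qed.

Definition digit_next (y : R) : R := (y - F (digit y)) / q (digit y).

Let next01 y : 0 <= y < 1 -> 0 <= digit_next y < 1.
Proof.
move=> y01; have /esym := digitP (digit y) y01; rewrite eqxx => /andP[h1 h2].
have qp : 0 < q (digit y) by rewrite -(ltrD2l (F (digit y))) addr0 (le_lt_trans h1).
by rewrite /digit_next ler_pdivlMr // ltr_pdivrMr // mul0r mul1r subr_ge0 h1 ltrBlDl.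
Qed.

Fixpoint digs (y : R) (k : nat) : seq 'I_N.+1 :=
  if k is k'.+1 then digit y :: digs (digit_next y) k' else [::].

Let digs_rcons y k : digs y k.+1 = rcons (digs y k) (digit (iter k digit_next y)).
Proof.
elim: k y => // k IH y.
by rewrite iterSr -[LHS]/(digit y :: digs (digit_next y) k.+1) IH.
Qed.

Let wid (s : seq 'I_N.+1) : R := \prod_(u <- s) q u.

Fixpoint digit_low (s : seq 'I_N.+1) : R := if s is u :: s' then F u + q u * digit_low s' else 0.

Let wid_ge0 s : 0 <= wid s. Proof. by rewrite prodr_ge0. Qed.

Let low_ge0 s : 0 <= digit_low s.
Proof. by elim: s => //= u s IH; rewrite addr_ge0 // mulr_ge0. Qed.

Let low_wid s : digit_low s + wid s <= 1.
Proof.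
elim: s => [|u s IH] /=; first by rewrite /wid big_nil add0r.
rewrite /wid big_cons -addrA -mulrDr (le_trans _ (Fq_le1 u)) // lerD2l.
by rewrite -[leRHS]mulr1 ler_wpM2l.
Qed.

Let digsE y s : 0 <= y < 1 -> (digs y (size s) == s) = (digit_low s <= y < digit_low s + wid s).
Proof.
elim: s y => [|u s IH] y y01 /=; first by rewrite /wid big_nil add0r y01.
rewrite eqseq_cons digitP // /wid big_cons -/(wid s) -addrA -mulrDr.
have [qu0|qun0] := eqVneq (q u) 0.
  rewrite /hit qu0 !mul0r addr0; case: (leP (F u) y); rewrite ?andbF ?andbT //.
have qp : 0 < q u by rewrite lt_neqAle eq_sym qun0 q0.
have [hu|nhu] := boolP (hit y u).
  have du : digit y = u by apply/eqP; rewrite digitP.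
  rewrite IH ?next01 // /digit_next du ler_pdivlMr // ltr_pdivrMr //.
  by rewrite lerBrDl ltrBlDl ![_ * q u]mulrC.
rewrite /=; apply/esym/negbTE; apply: contra nhu => /andP[h1 h2]; apply/andP; split.
  by rewrite (le_trans _ h1) // lerDl mulr_ge0.
by rewrite (lt_le_trans h2) // lerD2l -[leRHS]mulr1 ler_wpM2l.
Qed.

Variables (S : eqType) (step : S -> 'I_N.+1 -> S).

Fixpoint digit_chain (z : S) (y : R) (k : nat) : S :=
  if k is k'.+1 then digit_chain (step z (digit y)) (digit_next y) k' else z.

Fixpoint digit_follow (z : S) (y : R) (f : seq S) : bool :=
  if f is z' :: f' then (step z (digit y) == z') && digit_follow z' (digit_next y) f' else true.

Fixpoint follow_prob (z : S) (f : seq S) : R :=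
  if f is z' :: f' then (\sum_(u | step z u == z') q u) * follow_prob z' f' else 1.

Lemma chain_follow z y f : (mkseq (digit_chain z y) (size f).+1 == z :: f) = digit_follow z y f.
Proof.
elim: f z y => [|z' f IH] z y; first by rewrite /mkseq /= eqxx.
rewrite /mkseq /= eqseq_cons eqxx /= eqseq_cons.
have [<-/=|//] := eqVneq (step z (digit y)) z'.
rewrite -IH /mkseq /= eqseq_cons eqxx /=; congr (_ == _).
by rewrite (iotaDl 2 0) (iotaDl 1 0) -!map_comp.
Qed.

Let B (s : seq 'I_N.+1) (z : S) (f : seq S) : set R :=
  [set y | [&& 0 <= y < 1, digs y (size s) == s & digit_follow z (iter (size s) digit_next y) f]].

Let B_measure s z f : measurable (B s z f) /\
  lebesgue_measure (B s z f) = (wid s * follow_prob z f)%:E.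
Proof.
elim: f s z => [|z' f IH] s z.
  have -> : B s z [::] = [set` `[digit_low s, digit_low s + wid s[].
    apply/seteqP; split => y; rewrite /B /= andbT in_itv /=.
      by move=> /andP[y01]; rewrite digsE.
    move=> h; have y01 : 0 <= y < 1.
      move: h => /andP[h1 h2]; rewrite (le_trans _ h1) //=.
      exact: lt_le_trans h2 (low_wid s).
    by rewrite y01 digsE.
  split; first exact: measurable_itv.
  rewrite lebesgue_measure_itv /= lte_fin ltrDl mulr1.
  case: ltP => [w0|w0]; first by rewrite -EFinD addrAC subrr add0r.
  by congr (_%:E); apply/eqP; rewrite eq_le wid_ge0.
have Beq : B s z (z' :: f) =
    \big[setU/set0]_(u < N.+1 | step z u == z') B (rcons s u) z' f.
  transitivity (\big[setU/set0]_(u <- index_enum 'I_N.+1 | step z u == z')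
      B (rcons s u) z' f); last by [].
  rewrite -bigcup_seq_cond; apply/seteqP; split => y; rewrite /B /=.
    move=> /and3P[y01 /eqP ys /andP[sz fo]].
    exists (digit (iter (size s) digit_next y)); first by rewrite /= mem_index_enum.
    by rewrite /= y01 size_rcons digs_rcons ys eqxx.
  move=> [u /=]; rewrite mem_index_enum /= => /eqP <-.
  rewrite size_rcons digs_rcons eqseq_rcons.
  by move=> /and3P[-> /andP[-> /eqP ->] /= ->]; rewrite eqxx.
have tB : trivIset setT (fun u => B (rcons s u) z' f).
  apply/trivIsetP => u v _ _ uv; apply/seteqP; split => // y [] /and3P[_ + _] /and3P[_ + _].
  rewrite !size_rcons => /eqP -> /eqP/rcons_inj[vu]; by rewrite vu eqxx in uv.
have mB u : measurable (B (rcons s u) z' f) by case: (IH (rcons s u) z').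
split; first by rewrite Beq; apply: bigsetU_measurable => u _; exact: mB.
rewrite Beq measure_bigsetU_ord //.
rewrite (eq_bigr (fun u => (wid s * q u * follow_prob z' f)%:E)) => [|u _]; last first.
  have [_ eu] := IH (rcons s u) z'; apply: etrans eu _; congr (_%:E); congr (_ * _).
  by rewrite /wid -cats1 big_cat big_seq1.
by rewrite sumEFin /= mulrA mulr_sumr mulr_suml.
Qed.

Lemma follow_measure z f :
  measurable [set y : R | (0 <= y < 1) && digit_follow z y f] /\
  lebesgue_measure [set y : R | (0 <= y < 1) && digit_follow z y f] = (follow_prob z f)%:E.
Proof.
have -> : [set y : R | (0 <= y < 1) && digit_follow z y f] = B [::] z f.
  by [].
by have [? ->] := B_measure [::] z f; rewrite /wid big_nil mul1r.
Qed.

End Digits.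

Section RunMeasure.
Context {R : realType} {r : nat}.
Variables (P : cp_program R r) (x0 : 'rV[int]_r).

Let q (u : 'I_(cp_size P).+1) : R :=
  if unlift ord0 u is Some v then cp_prob P v else cp_exit_prob P.

Let step (z : 'rV[int]_r) (u : 'I_(cp_size P).+1) : 'rV[int]_r :=
  if in_guard P z then
    if unlift ord0 u is Some v then z + cp_step P v else cp_exit P
  else z.

Let q0 u : 0 <= q u.
Proof. by rewrite /q; case: unlift => [v|]; [exact: cp_prob_ge0|exact: cp_exit_prob_ge0]. Qed.

Let q1 : \sum_u q u = 1.
Proof.
rewrite big_ord_recl {1}/q unlift_none addrC -(cp_prob_sum P); congr (_ + _).
by apply: eq_bigr => u _; rewrite /q liftK.
Qed.

Let stepE z z' : \sum_(u | step z u == z') q u = trans_prob P z z'.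
Proof.
rewrite /step /trans_prob; case: ifP => gz.
  rewrite big_mkcond big_ord_recl /= {1}/q unlift_none eq_sym addrC [in RHS]big_mkcond.
  by congr (_ + _); apply: eq_bigr => u _; rewrite /q liftK.
by rewrite eq_sym; case: eqP => _; [rewrite q1|rewrite big_pred0].
Qed.

Let follow_probE z f : follow_prob q step z f = path_prob P z f.
Proof. by elim: f z => //= z' f IH z; rewrite stepE IH. Qed.

Let phi (y : R) : runs r :=
  if 0 <= y < 1 then digit_chain q step x0 y else fun=> x0.

Let I01 : set R := `[0, 1[.

Let phiI (z : 'rV[int]_r) (f : seq 'rV[int]_r) :
  phi @^-1` cylinder (z :: f) `&` I01 =
  if z == x0 then [set y : R | (0 <= y < 1) && digit_follow q step z y f] else set0.
Proof.
apply/seteqP; split => y.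
  rewrite /I01 /= in_itv /= /cylinder /phi /= => -[+ y01]; rewrite y01 => /eqP E.
  have [zx|/eqP nz] := eqVneq z x0; last first.
    by move: E; rewrite /mkseq /= eqseq_cons => /andP[/eqP /esym].
  by move: E; rewrite -zx chain_follow /= y01 => ->.
case: eqP => //= -> /andP[y01 fo]; rewrite /I01 /= in_itv /= y01; split => //.
by rewrite /phi y01; apply/eqP; rewrite -[_ == _]/(mkseq _ (size f).+1 == _) chain_follow.
Qed.

Let mphi : measurable_fun [set: measurableTypeR R] phi.
Proof.
apply: (@measurability _ _ (measurableTypeR R) (runs r) setT phi (range (@cylinder r))) => // _ [_ [f _ <-] <-].
rewrite setTI.
have mI : measurable (I01 : set (measurableTypeR R)) by exact: measurable_itv.
rewrite -(setIT (_ @^-1` _)) -(setUv I01) setIUr; apply: measurableU.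
  case: f => [|z f].
    by rewrite (_ : _ @^-1` _ = setT) ?setTI //; apply/seteqP.
  by rewrite phiI; case: ifP => // _; have [] := follow_measure q0 q1 step z f.
have [c|nc] := pselect (cylinder f ((fun=> x0) : run r)).
  rewrite (_ : _ `&` _ = ~` I01); first exact: measurableC.
  apply/seteqP; split => y; first by case.
  move=> ny; split => //; rewrite /preimage /= /phi.
  by move: ny; rewrite /I01 /= in_itv /=; case: ifP.
rewrite (_ : _ `&` _ = set0) //; apply/seteqP; split => // y [] /[swap].
by rewrite /I01 /= in_itv /= /phi; case: ifP.
Qed.

Lemma run_measure_exists :
  exists mu : probability (runs r) R, is_run_measure P x0 mu.
Proof.
have mI : measurable (I01 : set (measurableTypeR R)) by exact: measurable_itv.
pose m := mrestr (@lebesgue_measure R) mI.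
have m1 : m setT = 1%E.
  by rewrite /m /mrestr setTI /I01 lebesgue_measure_itv /= lte_fin ltr01 sube0.
pose U : probability (measurableTypeR R) R :=
  HB.pack m (Measure_isProbability.Build _ _ _ m m1).
pose X : {mfun measurableTypeR R >-> runs r} :=
  HB.pack (phi : measurableTypeR R -> runs r)
    (isMeasurableFun.Build _ _ (measurableTypeR R) (runs r) phi mphi).
exists (distribution U X : probability (runs r) R) => z f.
rewrite /distribution /pushforward /= /m /mrestr phiI.
case: eqP => [->|_]; last by rewrite measure0 mul0r.
by have [_ ->] := follow_measure q0 q1 step x0 f; rewrite mul1r follow_probE.
Qed.

End RunMeasure.

Section Runtime.
Context {R : realType} {r : nat}.
Implicit Types (P : cp_program R r) (w : runs r).

(* Any two probabilities satisfying is_run_measure agree, since the cylinders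
   together with the empty set form a generating pi-system: the choice made by
   cid is immaterial. *)
Definition run_prob P (x0 : 'rV[int]_r) : probability (runs r) R :=
  sval (cid (run_measure_exists P x0)).

Definition term_time P w : \bar R :=
  ereal_inf [set (i%:R)%:E | i in [set i : nat | ~~ in_guard P (w i)]].

Definition rt P (x0 : 'rV[int]_r) : \bar R :=
  if run_prob P x0 [set w | (term_time P w < +oo)%E] == 1%E
  then (\int[run_prob P x0]_w term_time P w)%E else +oo%E.

Definition PAST P : Prop := forall x0, (rt P x0 < +oo)%E.

End Runtime.

Definition guard_shift (R : realType) (r : nat) (P : cp_program R r)
    (u : 'I_(cp_size P)) : int := dotz (cp_guard P) (cp_step P u).
Arguments guard_shift {R r} P u.

Section RandomWalk.
Context {R : realType} {r : nat}.
Implicit Types (P : cp_program R r).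

Definition rdw P (z : 'rV[int]_r) : int := dotz (cp_guard P) z - cp_bound P.

Lemma max_decr_ex P : exists k : nat, [forall u, - k%:Z <= guard_shift P u].
Proof.
exists (\max_u `|guard_shift P u|)%N; apply/forallP => u; rewrite lerNl.
rewrite (le_trans (ler_norm _)) // normrN -abszE lez_nat.
exact: (leq_bigmax (F := fun u => `|guard_shift P u|%N)).
Qed.

Lemma max_incr_ex P : exists m : nat, [forall u, guard_shift P u <= m%:Z].
Proof.
exists (\max_u `|guard_shift P u|)%N; apply/forallP => u.
rewrite (le_trans (ler_norm _)) // -abszE lez_nat.
exact: (leq_bigmax (F := fun u => `|guard_shift P u|%N)).
Qed.

Definition max_decr P : nat := ex_minn (max_decr_ex P).
Definition max_incr P : nat := ex_minn (max_incr_ex P).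

Definition p_rdw P (j : int) : R := \sum_(u | guard_shift P u == j) cp_prob P u.

End RandomWalk.

(* The integer interval [-k, m] is enumerated as i - k for i < k + m + 1. *)
Definition rdw_index (R : realType) (r : nat) (P : cp_program R r)
    (i : 'I_(max_decr P + max_incr P).+1) : int := i%:Z - (max_decr P)%:Z.
Arguments rdw_index {R r} P i.

Section RandomWalkProgram.
Context {R : realType} {r : nat}.
Implicit Types (P : cp_program R r).

Lemma rdw_index_inj P : injective (rdw_index P).
Proof. by move=> i j /addIr [/val_inj]. Qed.

Lemma rdw_index_surj P u : exists i, rdw_index P i = guard_shift P u.
Proof.
have /forallP/(_ u) hk : [forall u, - (max_decr P)%:Z <= guard_shift P u].
  by rewrite /max_decr; case: ex_minnP.
have /forallP/(_ u) hm : [forall u, guard_shift P u <= (max_incr P)%:Z].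
  by rewrite /max_incr; case: ex_minnP.
have h0 : 0 <= guard_shift P u + (max_decr P)%:Z by rewrite -(addNr (max_decr P)%:Z) lerD2r.
have lt : (`|(guard_shift P u + (max_decr P)%:Z)%R| < (max_decr P + max_incr P).+1)%N.
  by rewrite ltnS -lez_nat abszE ger0_norm // PoszD [leRHS]addrC lerD2r.
by exists (Ordinal lt); rewrite /rdw_index /= gez0_abs // addrK.
Qed.

Lemma p_rdw_ge0 P j : 0 <= p_rdw P j.
Proof. by apply: sumr_ge0 => u _; exact: cp_prob_ge0. Qed.

Lemma p_rdw_sum P : \sum_i p_rdw P (rdw_index P i) + cp_exit_prob P = 1.
Proof.
rewrite -(cp_prob_sum P); congr (_ + _); rewrite /p_rdw.
rewrite (exchange_big_dep predT) //=; apply: eq_bigr => u _.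
have [i ei] := rdw_index_surj u; rewrite (big_pred1 i) // => j /=.
by rewrite -ei (inj_eq (rdw_index_inj (P := P))) eq_sym.
Qed.

Lemma rdw_step_inj P : injective (fun i => const_mx (rdw_index P i) : 'rV[int]_1).
Proof. by move=> i j /rowP/(_ 0); rewrite !mxE => /(rdw_index_inj (P := P)). Qed.

Lemma rdw_exitP P :
  dotz (const_mx 1 : 'rV[int]_1) (const_mx (rdw P (cp_exit P))) <= 0.
Proof. by rewrite /dotz big_ord1 !mxE mul1r subr_le0 cp_exitP. Qed.

Definition rdw_program P : cp_program R 1 :=
  @CPProgram R 1 (const_mx 1) 0 _
    (fun i => const_mx (rdw_index P i)) (fun i => p_rdw P (rdw_index P i))
    (const_mx (rdw P (cp_exit P))) (cp_exit_prob P)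
    (@rdw_step_inj P) (fun i => p_rdw_ge0 P (rdw_index P i))
    (cp_exit_prob_ge0 P) (p_rdw_sum P) (rdw_exitP P).

Definition drift P : R := \sum_i (rdw_index P i)%:~R * p_rdw P (rdw_index P i).

End RandomWalkProgram.

(* The loop body is x := x with probability 1, up to instructions of
   probability 0. *)
Definition idle (R : realType) (Q : cp_program R 1) : Prop :=
  cp_exit_prob Q = 0 /\ forall u, cp_prob Q u != 0 -> cp_step Q u = 0.

Definition trivial_program (R : realType) (r : nat) (P : cp_program R r) : Prop :=
  cp_guard P = 0 \/ idle (rdw_program P).

(* Main.v *)
(** Let q_n(z) be the probability that the walk started at z survives n steps.
    Then E(T) is the sum of the q_n. Write mu for the drift and k, m for the
    maximal decrease and increase of rdw in one step; optional stopping at min(n, T) gives,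
    with S_n the n-th partial sum,
    1 - k <= rdw z + mu * S_n <= (rdw z + n m) q_n   whenever rdw z > 0.
    If mu < 0 the left inequality bounds S_n from above. If E(T) is finite, then
    n q_n is small along even n, as q is nonincreasing and summable; the right
    inequality thus yields rdw z + mu E(T) <= 0, which gives the lower bound and
    forces mu < 0. *)
Require Import Defs.
From mathcomp Require Import all_boot all_order all_algebra.
From mathcomp Require Import all_classical all_reals all_analysis.
From mathcomp Require Import measurable_realfun lra.

Set Implicit Arguments.
Unset Strict Implicit.
Unset Printing Implicit Defensive.
Import Order.TTheory GRing.Theory Num.Theory.
Local Open Scope classical_set_scope.
Local Open Scope ring_scope.

(** * Survival probabilities and optional stopping of the walk [rdw] *)

Section Survival.
Context {R : realType} {r : nat}.
Implicit Types (P : cp_program R r) (z : 'rV[int]_r).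

(** This is the probability of T > n from [z]: the guard is tested at the n + 1 times 0, ..., n. A
    jump to [cp_exit] contributes nothing, since it leaves the guard. *)
Fixpoint survival P n z : R :=
  if in_guard P z then
    if n is n'.+1 then \sum_u cp_prob P u * survival P n' (z + cp_step P u) else 1
  else 0.

(** The expectation of min(n, T), as a sum of tail probabilities. *)
Definition truncated_rt P n z : R := \sum_(i < n) survival P i z.

Lemma survival_ge0 P n z : 0 <= survival P n z.
Proof.
elim: n z => [|n IH] z /=; case: ifP => // _.
by apply: sumr_ge0 => u _; rewrite mulr_ge0 ?cp_prob_ge0.
Qed.

Lemma survival_out P n z : ~~ in_guard P z -> survival P n z = 0.
Proof. by move=> /negbTE g; case: n => [|n] /=; rewrite g. Qed.

Lemma truncated_rt_out P n z : ~~ in_guard P z -> truncated_rt P n z = 0.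
Proof. by move=> g; apply: big1 => i _; rewrite survival_out. Qed.

Lemma truncated_rtS P n z : in_guard P z ->
  truncated_rt P n.+1 z =
  1 + \sum_u cp_prob P u * truncated_rt P n (z + cp_step P u).
Proof.
move=> g; rewrite /truncated_rt big_ord_recl /= g; congr (_ + _).
under [RHS]eq_bigr do rewrite mulr_sumr.
by rewrite exchange_big.
Qed.

Lemma rdw_gt0 P z : (0 < rdw P z) = in_guard P z.
Proof. by rewrite /rdw subr_gt0. Qed.

Lemma rdwD P z u : rdw P (z + cp_step P u) = rdw P z + guard_shift P u.
Proof.
rewrite /rdw /guard_shift addrAC; congr (_ - _); rewrite /dotz -big_split /=.
by apply: eq_bigr => i _; rewrite mxE mulrDr.
Qed.

Lemma guard_shift_ge P u : - (max_decr P)%:Z <= guard_shift P u.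
Proof. by rewrite /max_decr; case: ex_minnP => k /forallP. Qed.

Lemma guard_shift_le P u : guard_shift P u <= (max_incr P)%:Z.
Proof. by rewrite /max_incr; case: ex_minnP => k /forallP. Qed.

(** Each step has its displacement at exactly one index of the interval from -k to m, so the sum can
    be regrouped by steps. *)
Lemma driftE P : drift P = \sum_u cp_prob P u * (guard_shift P u)%:~R.
Proof.
rewrite /drift /p_rdw; under eq_bigr do rewrite mulr_sumr.
rewrite (exchange_big_dep predT) //=; apply: eq_bigr => u _.
have [i ei] := rdw_index_surj u; rewrite (big_pred1 i) => [|j /=].
  by rewrite ei mulrC.
by rewrite -ei (inj_eq (@rdw_index_inj _ _ P)) eq_sym.
Qed.

(** A large multiple of the guard vector a works, as [dotz a a] is a positive integer. This supplies
    a start at which the loop is entered. *)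
Lemma exists_rdw_gt0 P : cp_guard P != 0 -> exists z, 0 < rdw P z.
Proof.
move=> /eqP a0; set a := cp_guard P.
have [i ai] : exists i, a 0 i != 0.
  apply: contra_notP a0 => /forallNP a0; apply/rowP => i; rewrite mxE.
  by apply/eqP; apply: contraPT (a0 i) => ->; apply.
have da : 1 <= dotz a a.
  rewrite /dotz (bigD1 i) //= -[leLHS]addr0 lerD ?sumr_ge0 //.
    by rewrite -gtz0_ge1 -expr2 lt_neqAle sqr_ge0 andbT eq_sym sqrf_eq0.
  by move=> j _; rewrite -expr2 sqr_ge0.
exists ((`|cp_bound P| + 1) *: a); rewrite /rdw subr_gt0 -/a.
have -> : dotz a ((`|cp_bound P| + 1) *: a) = (`|cp_bound P| + 1) * dotz a a.
  by rewrite /dotz mulr_sumr; apply: eq_bigr => j _; rewrite mxE mulrCA.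
rewrite (le_lt_trans (ler_norm _)) // (lt_le_trans (y := `|cp_bound P| + 1)) ?ltrDl //.
by rewrite ler_peMr // addr_ge0.
Qed.

Section NoExit.
Context (P : cp_program R r) (no_exit : cp_exit_prob P = 0).

Lemma prob_sum1 : \sum_u cp_prob P u = 1.
Proof. by rewrite -(cp_prob_sum P) no_exit addr0. Qed.

Lemma prob_mean (c : R) : c = \sum_u cp_prob P u * c.
Proof. by rewrite -mulr_suml prob_sum1 mul1r. Qed.

Lemma survivalS_le n z : survival P n.+1 z <= survival P n z.
Proof.
elim: n z => [|n IH] z.
  rewrite /=; case: ifP => // _; rewrite -prob_sum1; apply: ler_sum => u _.
  by case: ifP; rewrite ?prob_sum1 ?mulr1 ?mulr0 ?cp_prob_ge0.
rewrite [leLHS]/= [leRHS]/=; case: ifP => // _.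
by apply: ler_sum => u _; rewrite ler_wpM2l ?cp_prob_ge0 // IH.
Qed.

Lemma survival_homo z : {homo (survival P)^~ z : m n / (m <= n)%N >-> n <= m}.
Proof.
apply: homo_leq => [x|y x t xy yt|n]; [exact: lexx|exact: le_trans yt xy|].
exact: survivalS_le.
Qed.

(* The left-hand side is the expectation of the walk stopped at min(n, T): its
   value there is at most rdw z + n * max_incr P if n < T, and at most 0
   otherwise. *)
Lemma stopped_rdw_le n z : (rdw P z)%:~R + drift P * truncated_rt P n z <=
  survival P n z * ((rdw P z)%:~R + n%:R * (max_incr P)%:R).
Proof.
elim: n z => [|n IH] z; have [g|g] := boolP (in_guard P z); last 1 first.
- rewrite truncated_rt_out // survival_out // mulr0 mul0r addr0 lerz0.
  by rewrite leNgt rdw_gt0.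
- by rewrite /truncated_rt big_ord0 /= g mulr0 mul0r mul1r.
- rewrite truncated_rt_out // survival_out // mulr0 mul0r addr0 lerz0.
  by rewrite leNgt rdw_gt0.
rewrite truncated_rtS // /= g mulrDr mulr1 addrA mulr_sumr mulr_suml.
(* The drift of the first step and [rdw P z] become averages over the steps, so the claim splits
   into one inequality per successor. *)
rewrite [X in _ + X + _]driftE [X in X + _ + _]prob_mean.
rewrite -big_split -big_split.
apply: ler_sum => u _ /=; rewrite -mulrA.
have := IH (z + cp_step P u); rewrite rdwD intrD => {}IH.
have p0 := cp_prob_ge0 u.
have q0 := survival_ge0 P n (z + cp_step P u).
have s : ((guard_shift P u)%:~R : R) <= (max_incr P)%:R.
  by rewrite -[leRHS]/((max_incr P)%:Z%:~R) ler_int guard_shift_le.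
rewrite [drift P * _]mulrCA -!mulrDr; apply: ler_wpM2l => //.
apply: le_trans IH _; apply: ler_wpM2l => //.
by rewrite -addn1 natrD mulrDl mul1r -!addrA lerD2l addrC lerD2l.
Qed.

(** Inside the guard [rdw] is at least 1, and a step loses at most k, so the stopped walk never
    falls below 1 - k. Assuming this invariant instead of positivity lets the induction reach
    successors outside the guard. *)
Lemma stopped_rdw_ge n z : 1 - (max_decr P)%:Z <= rdw P z ->
  1 - (max_decr P)%:R <= (rdw P z)%:~R + drift P * truncated_rt P n z.
Proof.
have cast y : 1 - (max_decr P)%:Z <= rdw P y ->
    1 - (max_decr P)%:R <= (rdw P y)%:~R :> R.
  by rewrite -(ler_int R) intrD mulrNz.
elim: n z => [|n IH] z hz.
  by rewrite /truncated_rt big_ord0 mulr0 addr0 cast.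
have [g|g] := boolP (in_guard P z); last first.
  by rewrite truncated_rt_out // mulr0 addr0 cast.
rewrite truncated_rtS // mulrDr mulr1 addrA mulr_sumr.
rewrite [X in _ + X + _]driftE [leLHS]prob_mean.
rewrite [X in X + _ + _]prob_mean.
rewrite -big_split -big_split.
apply: ler_sum => u _ /=.
rewrite [drift P * _]mulrCA -!mulrDr; apply: ler_wpM2l; first exact: cp_prob_ge0.
rewrite -intrD -rdwD; apply: IH; rewrite rdwD lerD ?guard_shift_ge //.
by rewrite -gtz0_ge1 rdw_gt0.
Qed.

End NoExit.
End Survival.

(** * From the run measure to survival probabilities and the run time series *)

Section RunSurvival.
Context {R : realType} {r : nat}.
Implicit Types (P : cp_program R r) (z : 'rV[int]_r) (w : runs r).

(** The offset [k] allows induction on [n] behind a fixed prefix of the run. *)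
Definition guarded P (k n : nat) : set (runs r) :=
  [set w | forall i, (i <= n)%N -> in_guard P (w (k + i)%N)].

Lemma measurable_cylinder f : measurable (cylinder f : set (runs r)).
Proof. by apply: sub_sigma_algebra; exists f. Qed.

Lemma measurable_guarded P k n : measurable (guarded P k n).
Proof.
have mg i : measurable [set w : runs r | in_guard P (w i)].
  (* The state at time i is read off a prefix of length i + 1, and there are countably many of
     these. Their length is positive, so the default 0 of [last] does not matter. *)
  pose F f : set (runs r) :=
    if (size f == i.+1) && in_guard P (last 0 f) then cylinder f else set0.
  rewrite (_ : mkset _ = \bigcup_f F f); last first.
    apply/seteqP; split => w /=.
      move=> g; exists (mkseq w i.+1) => //.
      rewrite /F size_mkseq eqxx mkseqS last_rcons /= g /cylinder /=.
      by rewrite size_rcons size_mkseq mkseqS.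
    move=> [f _]; rewrite /F; case: ifP => // /andP[/eqP sf].
    by rewrite /cylinder /= sf => + E; rewrite -E mkseqS last_rcons.
  apply: countable_bigcupT_measurable => [|f].
    exact: (@countableP (seq 'rV[int]_r : countType)).
  by rewrite /F; case: ifP => // _; exact: measurable_cylinder.
rewrite (_ : guarded P k n = \bigcap_(i in [set i | (i <= n)%N])
    [set w : runs r | in_guard P (w (k + i)%N)]) //.
by apply: bigcap_measurable; [exists 0%N|move=> i _; exact: mg].
Qed.

Lemma cylinder_rcons (f : seq 'rV[int]_r) z (w : runs r) :
  cylinder (rcons f z) w <-> cylinder f w /\ w (size f) = z.
Proof.
rewrite /cylinder /= size_rcons mkseqS; split => [/rcons_inj[]//|[-> ->]//].
Qed.

Lemma cylinder_last z (f : seq 'rV[int]_r) (w : runs r) :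
  cylinder (z :: f) w -> w (size f) = last z f.
Proof.
case/lastP: f => [|f y]; first by rewrite /cylinder /mkseq /= => -[].
by rewrite -rcons_cons => /cylinder_rcons[_]; rewrite last_rcons size_rcons.
Qed.

Lemma path_prob_rcons P z f y :
  path_prob P z (rcons f y) = path_prob P z f * trans_prob P (last z f) y.
Proof. by elim: f z => [|z' f IH] z /=; rewrite ?mulr1 ?mul1r // IH mulrA. Qed.

(** The step vectors are distinct, so only [u] leads from [z] to this successor. *)
Lemma trans_prob_step P z u : cp_exit_prob P = 0 -> in_guard P z ->
  trans_prob P z (z + cp_step P u) = cp_prob P u.
Proof.
move=> e0 g; rewrite /trans_prob g e0 if_same addr0 (big_pred1 u) // => v /=.
by rewrite (inj_eq (addrI z)) (inj_eq (@cp_step_inj _ _ P)).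
Qed.

Lemma bigsetU_ordP (T : Type) n (F : 'I_n -> set T) x :
  (\big[setU/set0]_(u < n) F u) x <-> exists u, F u x.
Proof.
rewrite -(bigcup_seq (index_enum 'I_n)); split => [[u _ Fu]|[u Fu]]; first by exists u.
by exists u => //=; rewrite mem_index_enum.
Qed.

Lemma measureI_null (d : measure_display) (T : measurableType d)
    (mu : probability T R) (A B C : set T) :
  measurable A -> measurable B -> measurable C -> A `\` B `<=` C ->
  mu C = 0%E -> mu A = mu (A `&` B).
Proof.
move=> mA mB mC ABC C0; apply: etrans (measureDI mu mA mB) _.
by rewrite (subset_measure0 _ mC ABC C0) ?add0e //; exact: measurableD.
Qed.

Section Measure.
Context (P : cp_program R r) (no_exit : cp_exit_prob P = 0).
Context (x0 : 'rV[int]_r) (mu : probability (runs r) R).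
Context (mu_run : is_run_measure P x0 mu).

Lemma run_measure_cylinder f : mu (cylinder (x0 :: f)) = (path_prob P x0 f)%:E.
Proof. by rewrite mu_run eqxx mul1r. Qed.

(** The one-step extensions of the prefix are disjoint and, as the step probabilities sum to 1,
    carry the full measure of its cylinder. *)
Lemma run_measure_step f : in_guard P (last x0 f) ->
  mu (cylinder (x0 :: f) `\`
      \big[setU/set0]_u cylinder (x0 :: rcons f (last x0 f + cp_step P u))) = 0%E.
Proof.
move=> g; set z := last x0 f; set U : set (runs r) := \big[setU/set0]_u _.
have mU : measurable U.
  by apply: bigsetU_measurable => u _; exact: measurable_cylinder.
have UE : mu U = (path_prob P x0 f)%:E.
  rewrite measure_bigsetU_ord //.
  - rewrite (eq_bigr (fun u => (path_prob P x0 f * cp_prob P u)%:E)) => [|u _]; last first.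
      by apply: etrans (run_measure_cylinder _) _; rewrite path_prob_rcons trans_prob_step.
    by rewrite sumEFin -mulr_sumr prob_sum1 // mulr1.
  - by move=> u; exact: measurable_cylinder.
  apply/trivIsetP => u v _ _ uv; apply/seteqP; split => // w [].
  rewrite -!rcons_cons => /cylinder_rcons[_ wu] /cylinder_rcons[_]; rewrite wu.
  by move=> /addrI/cp_step_inj/eqP; rewrite (negbTE uv).
have : mu (cylinder (x0 :: f)) = (mu (cylinder (x0 :: f) `\` U) + mu U)%E.
  apply: etrans (measureDI mu (measurable_cylinder (x0 :: f)) mU) _.
  congr (_ + mu _)%E; apply: setIidr => w /bigsetU_ordP[u].
  by rewrite -rcons_cons => /cylinder_rcons[].
rewrite UE run_measure_cylinder.
case: (mu _) => [x||] //; rewrite -EFinD => -[] /eqP.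
by rewrite -subr_eq subrr => /eqP <-.
Qed.

(** The Markov property, by induction on [n]: up to a null set, the event splits according to the
    step taken after [f]. *)
Lemma run_measure_guarded n f : mu (cylinder (x0 :: f) `&` guarded P (size f) n) =
  (path_prob P x0 f * survival P n (last x0 f))%:E.
Proof.
elim: n f => [|n IH] f; (have [g|g] := boolP (in_guard P (last x0 f)); last first).
- rewrite survival_out // mulr0 (_ : _ `&` _ = set0) ?measure0 //.
  apply/seteqP; split => // w [/cylinder_last wf /(_ 0%N isT)].
  by rewrite addn0 wf (negbTE g).
- rewrite /= g mulr1 -run_measure_cylinder; congr (mu _).
  apply/seteqP; split => [w []//|w cw]; split => // -[|//] _.
  by rewrite addn0 (cylinder_last cw).
- rewrite survival_out // mulr0 (_ : _ `&` _ = set0) ?measure0 //.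
  apply/seteqP; split => // w [/cylinder_last wf /(_ 0%N isT)].
  by rewrite addn0 wf (negbTE g).
set z := last x0 f; set E : set (runs r) := _ `&` _.
set U : set (runs r) := \big[setU/set0]_u cylinder (x0 :: rcons f (z + cp_step P u)).
have mE : measurable E.
  by apply: measurableI; [exact: measurable_cylinder|exact: measurable_guarded].
have mU : measurable U.
  by apply: bigsetU_measurable => u _; exact: measurable_cylinder.
rewrite (measureI_null mE mU _ _ (run_measure_step g)); first last.
- by move=> w [[? _] ?].
- by apply: measurableD => //; exact: measurable_cylinder.
pose F u : set (runs r) := cylinder (x0 :: rcons f (z + cp_step P u)) `&`
  guarded P (size (rcons f (z + cp_step P u))) n.
(* The prefix already decides the guard at time [size f], so what remains is a condition on the next
   n + 1 times, behind the extended prefix. *)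
have -> : E `&` U = \big[setU/set0]_u F u.
  apply/seteqP; split => w.
    move=> [[cw gw] /bigsetU_ordP[u cu]]; apply/bigsetU_ordP; exists u; split => //.
    by move=> i ni; rewrite size_rcons addSnnS gw.
  move=> /bigsetU_ordP[u [cu gu]]; split; last by apply/bigsetU_ordP; exists u.
  move: cu; rewrite -rcons_cons => /cylinder_rcons[cw _]; split => // -[_|i ni].
    by rewrite addn0 (cylinder_last cw).
  by have := gu _ ni; rewrite size_rcons addSnnS.
rewrite measure_bigsetU_ord.
- rewrite (eq_bigr (fun u => (path_prob P x0 f * cp_prob P u *
      survival P n (z + cp_step P u))%:E)) => [|u _]; last first.
    by apply: etrans (IH _) _; rewrite last_rcons path_prob_rcons trans_prob_step.
  rewrite sumEFin /= g mulr_sumr; congr (_%:E); apply: eq_bigr => u _.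
  by rewrite mulrA.
- by move=> u; apply: measurableI; [exact: measurable_cylinder|exact: measurable_guarded].
apply/trivIsetP => u v _ _ uv; apply/seteqP; split => // w [[+ _] [+ _]].
rewrite -!rcons_cons => /cylinder_rcons[_ wu] /cylinder_rcons[_]; rewrite wu.
by move=> /addrI/cp_step_inj/eqP; rewrite (negbTE uv).
Qed.

(** The case of an empty prefix: runs that do not start at [x0] form a null set. *)
Lemma run_measure_survival n : mu (guarded P 0 n) = (survival P n x0)%:E.
Proof.
have := run_measure_guarded n [::]; rewrite /= mul1r => <-.
rewrite setIC; apply: (@measureI_null _ (runs r) mu _ _ (~` cylinder [:: x0])).
- exact: measurable_guarded.
- exact: measurable_cylinder.
- by apply: measurableC; exact: measurable_cylinder.
- by move=> w [].
by rewrite probability_setC ?run_measure_cylinder ?subee //; exact: measurable_cylinder.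
Qed.

End Measure.

(** Yields the value +oo for runs that never leave the guard, and for starts with a positive
    probability of such runs. *)
Lemma nneseries_ge_cst (c : R) (u : (\bar R)^nat) : 0 < c ->
  (forall n, (c%:E <= u n)%E) -> (\sum_(0 <= n <oo) u n = +oo)%E.
Proof.
move=> c0 cu; apply: eq_infty => x.
have u0 n : (0 <= u n)%E by apply: le_trans (cu n); rewrite lee_fin ltW.
pose N := (Num.truncn (x / c)).+1.
apply: le_trans (nneseries_lim_ge N (fun n _ _ => u0 n)).
apply: (@le_trans _ _ (\sum_(0 <= i < N) c%:E)%E); last by apply: lee_sum.
rewrite sumEFin lee_fin sumr_const_nat subn0 -mulr_natl -ler_pdivrMr //.
exact/ltW/truncnS_gt.
Qed.

Lemma guardedPn P n w : ~ guarded P 0 n w -> exists2 i, (i <= n)%N & ~~ in_guard P (w i).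
Proof. by move=> /existsNP[i /not_implyP[ni /negP g]]; exists i. Qed.

(** The tail sum formula run by run: the indicator is 1 exactly for n < T. If the guard never fails,
    the infimum of the empty set and the sum of ones are both +oo. *)
Lemma term_time_series P w :
  term_time P w = (\sum_(0 <= n <oo) (\1_(guarded P 0 n) w)%:E)%E.
Proof.
rewrite /term_time; have [[i0 gi0]|/forallNP ng] := pselect (exists i, ~~ in_guard P (w i)).
  have ex : exists i, ~~ in_guard P (w i) by exists i0.
  case: (ex_minnP ex) => m gm mm.
  rewrite (nneseries_split 0 m) // eseries0 ?adde0; last first.
    move=> k mk _; rewrite indicE memNset //.
    by move=> /(_ m); rewrite add0n (negbTE gm) => /(_ mk).
  rewrite big_nat_cond (eq_bigr (fun=> 1%E)) => [|k /andP[/andP[_ km] _]]; last first.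
    rewrite indicE mem_set // => i ik; rewrite add0n; apply: contraLR ik => /mm mi.
    by rewrite -ltnNge (leq_trans km mi).
  rewrite -big_nat_cond sumEFin sumr_const_nat subn0.
  apply/le_anti/andP; split; first by apply: ereal_inf_lbound; exists m.
  by apply: le_ereal_inf_tmp => _ [i gi <-]; rewrite lee_fin ler_nat mm.
rewrite (_ : [set i | _] = set0) ?image_set0 ?ereal_inf0; last first.
  by apply/seteqP; split => // i /ng.
rewrite (nneseries_ge_cst (c := 1)) // => n; rewrite indicE mem_set //.
by move=> i _; rewrite add0n; apply: contraT => /ng.
Qed.

(** Integrate the tail sum formula termwise. If termination is not almost sure, both sides are +oo:
    every survival probability is at least the positive measure of the nonterminating runs. *)
Lemma rt_series P x0 : cp_exit_prob P = 0 ->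
  rt P x0 = (\sum_(0 <= n <oo) (survival P n x0)%:E)%E.
Proof.
move=> no_exit; rewrite /rt; set mu := run_prob P x0.
have mu_run : is_run_measure P x0 mu by rewrite /mu /run_prob; case: cid.
have muE n := run_measure_survival no_exit mu_run n.
case: ifPn => [_|].
  under eq_integral do rewrite term_time_series.
  rewrite integral_nneseries //.
  - apply: eq_eseriesr => n _; rewrite -muE -[in RHS](setIT (guarded P 0 n)).
    by apply: integral_indic => //; exact: measurable_guarded.
  - move=> n; apply/measurable_EFinP; apply: measurable_indic; exact: measurable_guarded.
pose B : set (runs r) := \bigcap_n guarded P 0 n.
have mB : measurable B by apply: bigcap_measurable => // n _; exact: measurable_guarded.
have -> : [set w | (term_time P w < +oo)%E] = ~` B.
  apply/seteqP; split => w /=.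
    move=> /[swap] Bw; rewrite term_time_series (nneseries_ge_cst (c := 1)) //.
    by move=> n; rewrite indicE mem_set //; exact: Bw.
  move=> /existsNP[n /not_implyP[_ /guardedPn[i _ gi]]].
  apply: (@le_lt_trans _ _ (i%:R)%:E); last exact: ltry.
  by apply: ereal_inf_lbound; exists i.
rewrite probability_setC // => mB0.
have Bn n : (mu B <= (survival P n x0)%:E)%E.
  by rewrite -muE le_measure ?inE //; [exact: measurable_guarded|move=> w; exact].
have B0 : (0 <= mu B)%E by exact: measure_ge0.
move: mB0 Bn B0; case: (mu B) => [c||] //; last by move=> _ /(_ 0%N).
rewrite lee_fin => c1 Bn c0; apply/esym/(nneseries_ge_cst (c := c)) => //.
rewrite lt_neqAle c0 andbT eq_sym; apply: contra c1 => /eqP ->.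
by rewrite sube0.
Qed.

Lemma truncated_rt_le_rt P n x0 : cp_exit_prob P = 0 ->
  ((truncated_rt P n x0)%:E <= rt P x0)%E.
Proof.
move=> no_exit; rewrite rt_series // /truncated_rt -sumEFin.
rewrite -(big_mkord xpredT (fun i => (survival P i x0)%:E)).
by apply: nneseries_lim_ge => i _ _; rewrite lee_fin survival_ge0.
Qed.

Lemma rt_le P x0 (C : R) : cp_exit_prob P = 0 ->
  (forall n, truncated_rt P n x0 <= C) -> (rt P x0 <= C%:E)%E.
Proof.
move=> no_exit hC; rewrite rt_series //; apply: lime_le.
  by apply: is_cvg_nneseries => i _ _; rewrite lee_fin survival_ge0.
by apply: nearW => n; rewrite big_mkord sumEFin lee_fin; exact: hC.
Qed.

End RunSurvival.

(** * Bounds on the expected run time *)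

Section Bounds.
Context {R : realType} {r : nat} (P : cp_program R r).
Context (no_exit : cp_exit_prob P = 0).

Lemma truncated_rt_homo z : {homo (truncated_rt P)^~ z : m n / (m <= n)%N >-> m <= n}.
Proof.
apply: homo_leq => [x|y x t|n]; [exact: lexx|exact: le_trans|].
by rewrite /truncated_rt big_ord_recr lerDl survival_ge0.
Qed.

(** Each of the n terms with index from n to 2n - 1 is at least the one with index 2n. *)
Lemma survival_double_le n z :
  n%:R * survival P n.*2 z <= truncated_rt P n.*2 z - truncated_rt P n z.
Proof.
rewrite lerBrDl /truncated_rt -addnn big_split_ord lerD2l mulr_natl.
rewrite -[n in _ *+ n]card_ord -sumr_const; apply: ler_sum => i _.
by apply: survival_homo => //=; rewrite leq_add2l ltnW.
Qed.

Lemma fin_rt_truncated_rt z (L e : R) : rt P z = L%:E -> 0 < e ->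
  exists n, L - e < truncated_rt P n z.
Proof.
move=> rtL e0; apply/not_existsP => no.
have /(rt_le no_exit) : forall n, truncated_rt P n z <= L - e.
  by move=> n; rewrite leNgt; apply/negP => /no.
by rewrite rtL lee_fin; lra.
Qed.

Lemma fin_rt_stopped_rdw z (L e : R) : rt P z = L%:E -> 0 < rdw P z -> 0 < e ->
  exists n, (rdw P z)%:~R + drift P * truncated_rt P n z <= e.
Proof.
move=> rtL z0 e0.
set x : R := (rdw P z)%:~R; set m : R := (max_incr P)%:R.
have x0 : 0 < x by rewrite ltr0z.
have m0 : 0 <= m by rewrite ler0n.
have c0 : 0 < x + 2 * m by lra.
(* The tolerance is chosen because x + 2nm <= (x + 2m) n for n >= 1; taking n = N + 1 below
   guarantees n >= 1. *)
have [N hN] := fin_rt_truncated_rt rtL (divr_gt0 e0 c0).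
exists N.+1.*2; apply: le_trans (stopped_rdw_le no_exit _ _) _; rewrite -/x -/m.
have hd := survival_double_le N.+1 z.
have hS : truncated_rt P N.+1.*2 z <= L.
  by rewrite -lee_fin -rtL truncated_rt_le_rt.
have hm : truncated_rt P N z <= truncated_rt P N.+1 z by exact: truncated_rt_homo.
have q0 := survival_ge0 P N.+1.*2 z.
have n1 : 1 <= N.+1%:R :> R by rewrite ler1n.
have ne : N.+1%:R * survival P N.+1.*2 z <= e / (x + 2 * m) by lra.
rewrite -[X in X%:R]muln2 natrM mulrC.
apply: (@le_trans _ _ ((x + 2 * m) * (N.+1%:R * survival P N.+1.*2 z))); last first.
  by rewrite -ler_pdivlMl // [_^-1 * _]mulrC.
rewrite mulrA; apply: ler_wpM2r => //.
by rewrite mulrAC; nra.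
Qed.

Lemma fin_rt_drift z (L : R) : rt P z = L%:E -> 0 < rdw P z ->
  drift P < 0 /\ (rdw P z)%:~R + drift P * L <= 0.
Proof.
move=> rtL z0; have x0 : 0 < (rdw P z)%:~R :> R by rewrite ltr0z.
have hS n : truncated_rt P n z <= L by rewrite -lee_fin -rtL truncated_rt_le_rt.
have d0 : drift P < 0.
  rewrite ltNge; apply/negP => d0.
  (* A nonnegative drift would keep the expectation at least [rdw P z], yet here it is at most half
     of that. *)
  have [n] := fin_rt_stopped_rdw rtL z0 (divr_gt0 x0 (ltr0n _ 2)).
  have : 0 <= truncated_rt P n z by apply: sumr_ge0 => i _; exact: survival_ge0.
  by move=> /(mulr_ge0 d0); lra.
split=> //; apply/ler_addgt0Pl => e e0; rewrite addr0.
(* With a negative drift, replacing the partial sum by its upper bound [L] only lowers the left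
   side. *)
have [n] := fin_rt_stopped_rdw rtL z0 e0; apply: le_trans.
by rewrite lerD2l ler_nM2l.
Qed.

Lemma rt_out z : rdw P z <= 0 -> rt P z = 0%E.
Proof.
rewrite leNgt rdw_gt0 => g; apply/le_anti/andP; split.
  by apply: rt_le => // n; rewrite truncated_rt_out.
by have := truncated_rt_le_rt 0 z no_exit; rewrite /truncated_rt big_ord0.
Qed.

Lemma rt_upper_bound z : drift P < 0 -> 0 < rdw P z ->
  (rt P z <= (- (drift P)^-1 * (rdw P z)%:~R
              + (1 - (max_decr P)%:R) / drift P)%:E)%E.
Proof.
move=> d0 z0; apply: rt_le => // n.
have /(stopped_rdw_ge no_exit n) h : 1 - (max_decr P)%:Z <= rdw P z.
  by rewrite (@le_trans _ _ 1) ?gerBl // -gtz0_ge1.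
rewrite mulNr -mulrC -mulNr -mulrDl ler_ndivlMr // mulrC; lra.
Qed.

Lemma rt_lower_bound z : drift P < 0 -> 0 < rdw P z ->
  ((- (drift P)^-1 * (rdw P z)%:~R)%:E <= rt P z)%E.
Proof.
(* The empty partial sum excludes the value -oo in the case distinction on [rt P z]. *)
move=> d0 z0; have := truncated_rt_le_rt 0 z no_exit.
case E : (rt P z) => [L||] //; rewrite ?leey // => _.
have [_ h] := fin_rt_drift E z0.
rewrite lee_fin mulNr -mulrC -mulNr ler_ndivrMr // mulrC; lra.
Qed.

End Bounds.

Theorem theorem21 (R : realType) (r : nat) (P : cp_program R r)
    (nontriv : ~ trivial_program P)
    (no_direct_termination : cp_exit_prob P = 0) :
  (PAST P <-> drift P < 0) /\
  (PAST P -> forall x0 : 'rV[int]_r,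
    (rdw P x0 <= 0 -> rt P x0 = 0%E) /\
    (0 < rdw P x0 ->
      ((- (drift P)^-1 * (rdw P x0)%:~R)%:E <= rt P x0)%E /\
      (rt P x0 <= (- (drift P)^-1 * (rdw P x0)%:~R
                   + (1 - (max_decr P)%:R) / drift P)%:E)%E)).
Proof.
have PAST_drift : PAST P -> drift P < 0.
  (* Non-triviality makes the guard vector nonzero, so some start enters the loop; its finite run
     time forces a negative drift. *)
  have guard0 : cp_guard P != 0 by apply/eqP => a0; apply: nontriv; left.
  move=> past; have [z z0] := exists_rdw_gt0 guard0.
  have := truncated_rt_le_rt 0 z no_direct_termination.
  have := past z; case E : (rt P z) => [L||] // _ _.
  by have [] := fin_rt_drift no_direct_termination E z0.
split; last first.
  move=> /PAST_drift d0 x0; split; first exact: rt_out.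
  by move=> z0; split; [exact: rt_lower_bound|exact: rt_upper_bound].
split=> // d0 z; case: (leP (rdw P z) 0) => z0; first by rewrite rt_out // ltry.
exact: le_lt_trans (rt_upper_bound no_direct_termination d0 z0) (ltry _).
Qed.
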